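(* Consider the eight properties $\mathsf{S}_{\mathrm{fin}}(\mathrm{D},\mathrm{D})$, $\mathsf{S}_{\mathrm{fin}}(\mathrm{D}_{\mathrm{o}},\mathrm{D})$, $\mathsf{S}_{\mathrm{fin}}(\mathrm{O},\mathrm{D})$, $\mathsf{S}_{\mathrm{fin}}(\mathrm{O},\mathrm{O})$, $\mathsf{S}_1(\mathrm{D},\mathrm{D})$, $\mathsf{S}_1(\mathrm{D}_{\mathrm{o}},\mathrm{D})$, $\mathsf{S}_1(\mathrm{O},\mathrm{D})$, $\mathsf{S}_1(\mathrm{O},\mathrm{O})$ of topological spaces, and the Dense Families Diagram, i.e., the directed graph on these eight properties with the arrows $\mathsf{S}_{\mathrm{fin}}(\mathrm{D},\mathrm{D})\to\mathsf{S}_{\mathrm{fin}}(\mathrm{D}_{\mathrm{o}},\mathrm{D})\to\mathsf{S}_{\mathrm{fin}}(\mathrm{O},\mathrm{D})$, $\ \mathsf{S}_{\mathrm{fin}}(\mathrm{O},\mathrm{O})\to\mathsf{S}_{\mathrm{fin}}(\mathrm{O},\mathrm{D})$, $\mathsf{S}_1(\mathrm{D},\mathrm{D})\to\mathsf{S}_1(\mathrm{D}_{\mathrm{o}},\mathrm{D})\to\mathsf{S}_1(\mathrm{O},\mathrm{D})$, $\ \mathsf{S}_1(\mathrm{O},\mathrm{O})\to\mathsf{S}_1(\mathrm{O},\mathrm{D})$, $\mathsf{S}_1(\mathrm{D},\mathrm{D})\to\mathsf{S}_{\mathrm{fin}}(\mathrm{D},\mathrm{D})$, $\ \mathsf{S}_1(\mathrm{D}_{\mathrm{o}},\mathrm{D})\to\mathsf{S}_{\mathrm{fin}}(\mathrm{D}_{\mathrm{o}},\mathrm{D})$,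 $\ \mathsf{S}_1(\mathrm{O},\mathrm{D})\to\mathsf{S}_{\mathrm{fin}}(\mathrm{O},\mathrm{D})$, $\ \mathsf{S}_1(\mathrm{O},\mathrm{O})\to\mathsf{S}_{\mathrm{fin}}(\mathrm{O},\mathrm{O})$, $\mathsf{S}_{\mathrm{fin}}(\mathrm{D},\mathrm{D})\to\mathsf{S}_1(\mathrm{O},\mathrm{D})$. No implication can be added to this diagram, except for those obtained by composition of existing ones, and this is exhibited by ZFC examples. That is, whenever $P,Q$ are two of the eight properties such that there is no directed path (of length $\ge 0$) from $P$ to $Q$ in the diagram, there is (provably in ZFC) a topological space that satisfies $P$ but not $Q$.
   Context: Let $X$ be a topological space. A family $\mathcal{U}\subseteq P(X)$ of subsets of $X$ is a dense family if $\bigcup\mathcal{U}$ is a dense subset of $X$. $\mathrm{D}$ is the collection of all dense families in $X$; $\mathrm{D}_{\mathrm{o}}$ is the collection of all dense families in $X$ all of whose members are open; $\mathrm{O}$ is the collection of all open covers of $X$. For collections $\mathscr{A},\mathscr{B}$ of families of subsets of $X$: $\mathsf{S}_1(\mathscr{A},\mathscr{B})$ means: for all $\mathcal{U}_1,\mathcal{U}_2,\dots\in\mathscr{A}$ there are $U_1\in\mathcal{U}_1,U_2\in\mathcal{U}_2,\dots$ such that $\{U_n : n\in\mathbb{N}\}\in\mathscr{B}$; $\mathsf{S}_{\mathrm{fin}}(\mathscr{A},\mathscr{B})$ means: for all $\mathcal{U}_1,\mathcal{U}_2,\dots\in\mathscr{A}$ there are finite $\mathcal{F}_1\subseteq\mathcal{U}_1,\mathcal{F}_2\subseteq\mathcal{U}_2,\dots$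 such that $\bigcup_n\mathcal{F}_n\in\mathscr{B}$. A space satisfies such a property if it holds with the collections computed in that space. *)

(* Defs.v *)
From Stdlib Require Export Relation_Operators.
From mathcomp Require Export all_boot.
From mathcomp Require Export boolp classical_sets functions cardinality topology.

Set Implicit Arguments.
Unset Strict Implicit.
Unset Printing Implicit Defensive.

Local Open Scope classical_set_scope.

Definition dense_families (X : topologicalType) : set (set (set X)) :=
  [set U | dense (\bigcup_(A in U) A)].

Definition dense_open_families (X : topologicalType) : set (set (set X)) :=
  [set U | dense_families U /\ U `<=` open].

Definition open_covers (X : topologicalType) : set (set (set X)) :=
  [set U | U `<=` open /\ \bigcup_(A in U) A = setT].

Arguments dense_families X : clear implicits.
Arguments dense_open_families X : clear implicits.
Arguments open_covers X : clear implicits.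

Definition S1 (X : Type) (A B : set (set (set X))) : Prop :=
  forall U : nat -> set (set X), (forall n, A (U n)) ->
  exists V : nat -> set X, (forall n, U n (V n)) /\ B (range V).

Definition Sfin (X : Type) (A B : set (set (set X))) : Prop :=
  forall U : nat -> set (set X), (forall n, A (U n)) ->
  exists F : nat -> set (set X),
    (forall n, finite_set (F n) /\ F n `<=` U n) /\ B (\bigcup_n F n).

Inductive property : Set :=
  | Sfin_D_D | Sfin_Do_D | Sfin_O_D | Sfin_O_O
  | S1_D_D | S1_Do_D | S1_O_D | S1_O_O.

Definition satisfies (X : topologicalType) (P : property) : Prop :=
  match P with
  | Sfin_D_D  => Sfin (dense_families X) (dense_families X)
  | Sfin_Do_D => Sfin (dense_open_families X) (dense_families X)
  | Sfin_O_D  => Sfin (open_covers X) (dense_families X)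
  | Sfin_O_O  => Sfin (open_covers X) (open_covers X)
  | S1_D_D    => S1 (dense_families X) (dense_families X)
  | S1_Do_D   => S1 (dense_open_families X) (dense_families X)
  | S1_O_D    => S1 (open_covers X) (dense_families X)
  | S1_O_O    => S1 (open_covers X) (open_covers X)
  end.

Inductive arrow : property -> property -> Prop :=
  | arrow_Sfin_D_Do    : arrow Sfin_D_D Sfin_Do_D
  | arrow_Sfin_Do_O    : arrow Sfin_Do_D Sfin_O_D
  | arrow_Sfin_OO_OD   : arrow Sfin_O_O Sfin_O_D
  | arrow_S1_D_Do      : arrow S1_D_D S1_Do_D
  | arrow_S1_Do_O      : arrow S1_Do_D S1_O_D
  | arrow_S1_OO_OD     : arrow S1_O_O S1_O_D
  | arrow_S1_Sfin_DD   : arrow S1_D_D Sfin_D_D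
  | arrow_S1_Sfin_DoD  : arrow S1_Do_D Sfin_Do_D
  | arrow_S1_Sfin_OD   : arrow S1_O_D Sfin_O_D
  | arrow_S1_Sfin_OO   : arrow S1_O_O Sfin_O_O
  | arrow_SfinDD_S1OD  : arrow Sfin_D_D S1_O_D.

(* [clos_refl_trans] also contains the paths of length 0. *)
Definition diagram_path : property -> property -> Prop :=
  clos_refl_trans property arrow.

(* Main.v *)
Require Import Defs.
From HB Require Import structures.
From mathcomp Require Import finmap.

(** Every arrow of the diagram is a true implication on nonempty spaces, so a
    space with P0 and without Q0 separates every P reachable from P0 from every
    Q that reaches Q0. Six separations then account for all pairs without a
    path. No separation axiom is asked of the spaces, which keeps the first
    four of them elementary:

    - S1(D,D) without Sfin(O,O): an uncountable set with the particular point
      topology. A family is dense as soon as its union contains the particular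
      point p, but the cover by the pairs {x, p} has no countable subcover.
    - S1(O,O) without Sfin(D_o,D): an uncountable discrete space with one more
      point whose only neighbourhood is the whole space. Every open cover
      contains the whole space, but the isolated singletons form a dense open
      family with no countable dense subfamily.
    - S1(D_o,D) without Sfin(D,D): an uncountable set with the cocountable
      topology. Every nonempty open set is dense, but no countable set is.
    - Sfin(O,O) without S1(O,D): the Cantor space with an isolated twin f'
      attached to each f. It is compact; but selecting one of
      the halves {f(n) = 0}, {f(n) = 1} for each n leaves out some f, and with
      it the nonempty open set {f'}.

    The remaining two, Sfin(D,D) without S1(D_o,D) and Sfin(D_o,D) without
    S1(O,D), come from one tree. Its nodes are finite sequences t_0, t_1, ...
    of bit strings, read as excluded cylinders: a g in (2^nat)^nat
    avoids the node if no t_n is an initial segment of g(n). A basic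
    neighbourhood of a node consists of its extensions that are avoided by
    finitely many prescribed elements g_0, ..., g_(k-1), all of which avoid
    the node itself. Two facts are played against each other.

    - One can diagonalise against single selections: given one string t_n for
      each n, some g has t_n as an initial segment of g(n) for every n, so the
      open set of nodes avoided by g meets none of the open sets 'the n-th
      entry is t_n' ([escapesN]). On the other hand these open sets, n being
      fixed, have a dense union, because a node can always be extended by
      strings escaping finitely many given g's ([escapes_diagonal]).
    - The tuples (g_0, ..., g_(k-1)) range over a Cantor cube, which is
      compact, and being avoided is a clopen condition on the tuple. So for
      each of the countably many pairs (k, s), finitely many members of a
      dense family already meet all neighbourhoods of the node s
      given by k elements ([finite_capture]); treating the n-th pair with the
      n-th dense family gives Sfin ([countable_capture]).

    On the nodes themselves this yields the first separation. On the infinite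
    branches, with the analogous topology, the argument for Sfin persists for
    open families, because an open set containing a branch contains a basic
    set given by one of its nodes; and the sets 'the n-th entry is t' now
    cover the space, so that even S1(O,D) fails. *)

Local Open Scope classical_set_scope.

Set Implicit Arguments.
Unset Strict Implicit.
Unset Printing Implicit Defensive.

(** * The arrows of the diagram *)

Lemma open_cover_dense_open (X : topologicalType) (U : set (set X)) :
  open_covers X U -> dense_open_families X U.
Proof.
by move=> [oU UT]; split=> //; rewrite /dense_families /= UT => O ? _; rewrite setIT.
Qed.

Lemma open_cover_point (X : topologicalType) (U : set (set X)) (x : X) :
  open_covers X U -> exists2 A, U A & A x.
Proof. by move=> [_ UT]; have : [set: X] x by []; rewrite -UT => -[A]; exists A. Qed.

Lemma S1_mono (X : Type) (A A' B B' : set (set (set X))) :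
  A' `<=` A -> B `<=` B' -> S1 A B -> S1 A' B'.
Proof.
move=> sA sB h U hU; have [n|V [UV BV]] := h U; first exact/sA.
by exists V; split=> //; exact: sB.
Qed.

Lemma Sfin_mono (X : Type) (A A' B B' : set (set (set X))) :
  A' `<=` A -> B `<=` B' -> Sfin A B -> Sfin A' B'.
Proof.
move=> sA sB h U hU; have [n|F [UF BF]] := h U; first exact/sA.
by exists F; split=> //; exact: sB.
Qed.

Lemma S1_Sfin (X : Type) (A B : set (set (set X))) : S1 A B -> Sfin A B.
Proof.
move=> h U /h[V [UV BV]]; exists (fun n => [set V n]); split.
  by move=> n; split; [exact: finite_set1 | move=> _ ->].
suff -> : \bigcup_n [set V n] = range V by [].
by apply/seteqP; split=> [_ [n _ ->]|_ [n _ <-]]; exists n.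
Qed.

Lemma countable_bigcup_families (X : Type) (F : nat -> set (set X)) :
  (forall n, finite_set (F n) /\ (forall A, F n A -> countable A)) ->
  countable (\bigcup_(A in \bigcup_n F n) A).
Proof.
move=> hF; apply: bigcup_countable => [|A [n _]]; last exact: (hF n).2.
by apply: bigcup_countable => // n _; exact/finite_set_countable/(hF n).1.
Qed.

Lemma Sfin_singletons_countable (X : Type) (F : nat -> set (set X)) :
  (forall n, finite_set (F n) /\ F n `<=` range set1) ->
  countable (\bigcup_(A in \bigcup_n F n) A).
Proof.
move=> hF; apply: countable_bigcup_families => n.
by split=> [|A /(hF n).2[x _ <-]]; [exact: (hF n).1 | exact: countable1].
Qed.

Lemma singletons_dense (X : topologicalType) :
  dense_families X (range (@set1 X)).
Proof. by move=> O [x Ox] _; exists x; split=> //; exists [set x] => //; exists x. Qed.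

(** Applying Sfin(D,D) to the family of singletons produces a countable dense
    set; from the n-th cover one then selects a member containing its n-th
    point. *)
Lemma Sfin_D_D_S1_O_D (X : topologicalType) : [set: X] !=set0 ->
  satisfies X Sfin_D_D -> satisfies X S1_O_D.
Proof.
move=> [x0 _] /(_ (fun=> range set1) (fun=> @singletons_dense X))[F [hF dF]].
have /countable_injP[f finj] := Sfin_singletons_countable hF.
set C := (X in {in X &, _}) in finj.
pose e n := xget x0 [set x | C x /\ f x = n].
move=> U hU.
have /choice[V hV] n : exists A, U n A /\ A (e n).
  by have [A UA Ae] := open_cover_point (e n) (hU n); exists A.
exists V; split=> [n|O O0 oO]; first exact: (hV n).1.
have [x [Ox Cx]] := dF O O0 oO; exists x; split=> //.
(* [e] inverts the injection [f] of the countable dense set [C] into nat. *)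
have [Ce fe] : C (e (f x)) /\ f (e (f x)) = f x.
  by apply: (@xgetI _ x0 [set y | C y /\ f y = f x] x).
have ex : e (f x) = x := finj _ _ (mem_set Ce) (mem_set Cx) fe.
by exists (V (f x)); [exists (f x) | have := (hV (f x)).2; rewrite ex].
Qed.

Lemma satisfies_arrow (X : topologicalType) (P Q : property) :
  [set: X] !=set0 -> arrow P Q -> satisfies X P -> satisfies X Q.
Proof.
have DoD : dense_open_families X `<=` dense_families X by move=> U [].
have ODo := @open_cover_dense_open X.
have OD : open_covers X `<=` dense_families X by move=> U /ODo /DoD.
move=> X0; case; try exact: S1_Sfin;
  try (by apply: S1_mono); try (by apply: Sfin_mono).
exact: Sfin_D_D_S1_O_D.
Qed.

Lemma satisfies_path (X : topologicalType) (P Q : property) :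
  [set: X] !=set0 -> diagram_path P Q -> satisfies X P -> satisfies X Q.
Proof.
by move=> X0; elim=> [??|//|? ? ? _ h1 _ h2 /h1/h2]; first exact: satisfies_arrow.
Qed.

(** * Topologies from neighbourhood systems *)

(** The open sets of [space S] below are those containing a base set of each of
    their points; directedness makes them closed under intersection. *)
Record nbhd_system (T : Type) := NbhdSystem {
  base : T -> set (set T);
  base_nonempty : forall x, base x !=set0;
  base_directed : forall x A B, base x A -> base x B ->
    exists2 C, base x C & C `<=` A `&` B }.

Definition space (T : Type) (S : nbhd_system T) : Type := T.

Section SpaceTopology.
Variables (T : Type) (S : nbhd_system T).

HB.instance Definition _ := gen_eqMixin (space S).
HB.instance Definition _ := gen_choiceMixin (space S).

Definition space_open : set (set (space S)) :=
  [set O | forall x, O x -> exists2 N, base S x N & N `<=` O].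

Lemma space_openT : space_open setT.
Proof. by move=> x _; have [N ?] := base_nonempty S x; exists N. Qed.

Lemma space_openI : setI_closed space_open.
Proof.
move=> A B oA oB x [/oA[M bM MA] /oB[N bN NB]].
have [C bC CMN] := base_directed bM bN.
by exists C => // y /CMN[/MA ? /NB].
Qed.

Lemma space_open_bigU (I : Type) (f : I -> set (space S)) :
  (forall i, space_open (f i)) -> space_open (\bigcup_i f i).
Proof.
by move=> of_ x [i _ /of_[N bN Nf]]; exists N => // y /Nf; exists i.
Qed.

HB.instance Definition _ := isOpenTopological.Build (space S)
  space_openT space_openI space_open_bigU.

Lemma openP (O : set (space S)) :
  open O <-> forall x, O x -> exists2 N, base S x N & N `<=` O.
Proof. by []. Qed.

End SpaceTopology.

(** * Three examples on an uncountable set *)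

Notation reals := (nat -> bool).

Lemma reals_uncountable : ~ countable [set: reals].
Proof.
move=> /countable_injP[f finj].
pose y n := `[< exists2 x : reals, f x = n & x n = false >].
have inj x z : f x = f z -> x = z := finj x z (mem_set I) (mem_set I).
case E : (y (f y)).
  by have /asboolP[x /inj ->] := E; rewrite E.
by have /asboolP : y (f y) = false by []; case; exists y.
Qed.

Lemma countable_exists_notin (C : set reals) : countable C -> exists x, ~ C x.
Proof.
move=> cC; apply/existsNP => CT; apply: reals_uncountable.
by have -> : [set: reals] = C by apply/seteqP; split=> // x _; exact: CT.
Qed.

Definition particular_point : nbhd_system reals.
Proof.
exists (fun x => [set [set x; (fun=> false) : reals]]).
- by move=> x; exists [set x; (fun=> false)].
- by move=> x _ _ -> ->; exists [set x; (fun=> false)] => // y.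
Defined.

Lemma particular_point_S1_D_D : satisfies (space particular_point) S1_D_D.
Proof.
pose p : space particular_point := (fun=> false).
have pO O : O !=set0 -> open O -> O p.
  by move=> [x Ox] /openP/(_ x Ox)[_ -> ]; apply; right.
move=> U dU; have /choice[V hV] n : exists A, U n A /\ A p.
  have [||_ [-> [A UA Ap]]] := dU n [set p]; [by exists p| |by exists A].
  by apply/openP => _ ->; exists [set p; p] => // y; case.
exists V; split=> [n|O O0 oO]; first exact: (hV n).1.
exists p; split; first exact: pO.
by exists (V 0); [exists 0 | exact: (hV 0).2].
Qed.

Lemma particular_point_not_Sfin_O_O :
  ~ satisfies (space particular_point) Sfin_O_O.
Proof.
pose p : space particular_point := (fun=> false).
pose pair x : set (space particular_point) := [set x; p].
case/(_ (fun=> range pair)) => [n|F [hF [_ FT]]].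
  split=> [_ [x _ <-]|]; last first.
    by apply/seteqP; split=> // x _; exists (pair x); [exists x | left].
  by apply/openP => y xy; exists (pair y) => // z [->//|->]; right.
apply: reals_uncountable; rewrite -[[set: reals]]FT.
apply: countable_bigcup_families => n; split=> [|A /(hF n).2[x _ <-]].
  exact: (hF n).1.
exact/finite_set_countable/finite_set2.
Qed.

Definition discrete_with_focal : nbhd_system (option reals).
Proof.
exists (fun x => [set if x is Some _ then [set x] else setT]).
- by move=> x; eexists.
- by move=> x _ _ -> ->; eexists; first by [].
Defined.

Lemma discrete_with_focal_S1_O_O : satisfies (space discrete_with_focal) S1_O_O.
Proof.
move=> U hU.
have UT n : U n setT.
  have [A UA /((hU n).1 _ UA)[_ -> TA]] :=
    open_cover_point (None : space discrete_with_focal) (hU n).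
  by have <- : A = setT by apply/seteqP; split.
exists (fun=> setT); split=> //; split=> [_ [n _ <-]|]; first exact: openT.
by apply/seteqP; split=> // x _; exists setT => //; exists 0.
Qed.

Lemma discrete_with_focal_not_Sfin_Do_D :
  ~ satisfies (space discrete_with_focal) Sfin_Do_D.
Proof.
pose pt (x : reals) : set (space discrete_with_focal) := [set Some x].
have opt x : open (pt x) by apply/openP => _ ->; exists (pt x).
case/(_ (fun=> range pt)) => [n|F [hF dF]].
  split=> [O [x Ox] oO|_ [x _ <-]]; last exact: opt.
  suff [y Oy] : exists y, O (Some y).
    by exists (Some y); split=> //; exists (pt y) => //; exists y.
  case: x Ox => [y Oy|/oO[_ -> OT]]; first by exists y.
  by exists (fun=> false); exact: OT.
have cF : countable (\bigcup_(A in \bigcup_n F n) A).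
  apply: countable_bigcup_families => n; split=> [|A /(hF n).2[x _ <-]].
    exact: (hF n).1.
  exact: countable1.
have /countable_exists_notin[x] : countable
    (Some @^-1` (\bigcup_(A in \bigcup_n F n) A) : set reals).
  have /countable_injP[f finj] := cF.
  apply/countable_injP; exists (f \o Some) => a b /set_mem Fa /set_mem Fb.
  by move=> /(finj (Some a) (Some b) (mem_set Fa) (mem_set Fb)) [].
by have [||_ [-> /=]] := dF (pt x); [exists (Some x)| exact: opt| ].
Qed.

Definition cocountable : nbhd_system reals.
Proof.
exists (fun=> [set N | countable (~` N)]).
- by move=> x; exists setT; rewrite /= setCT.
- move=> x A B cA cB; exists (A `&` B) => //=.
  rewrite setCI -bigcup2E; apply: bigcup_countable => // -[|[|n]] _ //=.
Defined.

Lemma cocountable_open (O : set reals) :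
  countable (~` O) -> open (O : set (space cocountable)).
Proof. by move=> cO; apply/openP => x _; exists O. Qed.

Lemma cocountable_openI (A B : set (space cocountable)) :
  A !=set0 -> B !=set0 -> open A -> open B -> A `&` B !=set0.
Proof.
move=> [x Ax] [y By] /openP/(_ x Ax)[M cM MA] /openP/(_ y By)[N cN NB].
have [C cC CMN] := @base_directed _ cocountable x M N cM cN.
have [z /contrapT /CMN[Mz Nz]] := countable_exists_notin cC.
by exists z; split; [exact: MA | exact: NB].
Qed.

Lemma cocountable_S1_Do_D : satisfies (space cocountable) S1_Do_D.
Proof.
move=> U dU; have /choice[V hV] n : exists A, U n A /\ A !=set0.
  have [|x [_ [A UA Ax]]] := (dU n).1 setT _ openT; first by exists (fun=> false).
  by exists A; split=> //; exists x.
exists V; split=> [n|O O0 oO]; first exact: (hV n).1.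
have oV : open (V 0) by apply: (dU 0).2; exact: (hV 0).1.
have [x [Ox Vx]] := cocountable_openI O0 (hV 0).2 oO oV.
by exists x; split=> //; exists (V 0) => //; exists 0.
Qed.

Lemma cocountable_not_Sfin_D_D : ~ satisfies (space cocountable) Sfin_D_D.
Proof.
case/(_ (fun=> range set1)) => [n|F [hF dF]]; first exact: singletons_dense.
have cC := Sfin_singletons_countable hF.
have [x Cx] := countable_exists_notin cC.
have [||y [/= ]//] := dF (~` (\bigcup_(A in \bigcup_n F n) A)).
  by exists x.
by apply: cocountable_open; rewrite setCK.
Qed.

(** * Compactness of Cantor cubes *)

HB.instance Definition _ (I : Type) :=
  isPointed.Build (prod_topology (fun _ : I => bool)) (fun=> false).

Lemma agree_nbhs (I : eqType) (f : prod_topology (fun _ : I => bool)) (l : seq I) :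
  nbhs f [set g : prod_topology (fun _ : I => bool) | {in l, g =1 f}].
Proof.
elim: l => [|i l ih]; first by apply: filterS filterT => g _ i.
have fi : nbhs f [set g : prod_topology (fun _ : I => bool) | g i = f i].
  exact: (@proj_continuous I (fun=> bool) i f [set f i]).
apply: filterS (filterI fi ih) => g [gi gl] j.
by rewrite inE => /predU1P[->//|/gl].
Qed.

(** Compactness of the Cantor cube on [I], with openness spelled out:
    a set is open when membership of each of its points is forced by finitely
    many coordinates. *)
Lemma cantor_finite_subcover (I : eqType) (J : choiceType) (D : set J)
    (O : J -> set (I -> bool)) :
  (forall j f, D j -> O j f -> exists l : seq I, forall g, {in l, g =1 f} -> O j g) ->
  (forall f, exists2 j, D j & O j f) ->
  exists E : set J, [/\ finite_set E, E `<=` D & forall f, exists2 j, E j & O j f].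
Proof.
move=> oO cO; pose P := prod_topology (fun _ : I => bool).
have : compact [set: P].
  have := @tychonoff I (fun=> bool) (fun=> setT) (fun=> bool_compact).
  by congr (compact _); apply/seteqP; split.
rewrite compact_cover => /(_ J D O)[j Dj|f _|E ED EO].
- rewrite openE => f /(oO _ _ Dj)[l hl]; rewrite /interior.
  by apply: filterS (agree_nbhs f l) => g /hl.
- by have [j] := cO f; exists j.
exists [set` E]; split; first exact: finite_fset.
  by move=> j /= /ED /set_mem.
by move=> f; have [//|j] := EO f; exists j.
Qed.

(** * A compact space without S1(O, D) *)

Definition strip (n : nat) (f : reals) : set (reals * bool) :=
  [set z : reals * bool | {in iota 0 n, z.1 =1 f}].

(** [(f, false)] is the point [f] of the Cantor space and [(f, true)] its isolated
    twin, which lies in every neighbourhood of [f]. *)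
Definition duplicate : nbhd_system (reals * bool).
Proof.
exists (fun y : reals * bool =>
  if y.2 then [set [set y]] else range (fun n => strip n y.1)).
- by move=> [f []] /=; [exists [set (f, true)] | exists (strip 0 f); exists 0].
- move=> [f []] /= A B; first by move=> -> ->; exists [set (f, true)].
  move=> [m _ <-] [n _ <-]; exists (strip (maxn m n) f); first by exists (maxn m n).
  move=> z zf; split=> i; rewrite mem_iota => /= ilt; apply: zf;
    by rewrite mem_iota /= leq_max ilt ?orbT.
Defined.

(** An open set containing [(f, false)] contains both copies of a cylinder
    around [f], so compactness of the Cantor space carries over. *)
Lemma duplicate_Sfin_O_O : satisfies (space duplicate) Sfin_O_O.
Proof.
move=> U hU; pose O (A : set (space duplicate)) := [set f | forall b, A (f, b)].
have sub n A f : U n A -> A (f, false) ->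
    exists l : seq nat, forall g, {in l, g =1 f} -> O A g.
  move=> /(hU n).1/openP oA /oA[_ [m _ <-] mA].
  by exists (iota 0 m) => g gf b; exact: mA.
have /choice[F hF] n : exists E, [/\ finite_set E, E `<=` U n &
    forall f, exists2 A, E A & O A f].
  apply: cantor_finite_subcover => [A f UA /(_ false)|f]; first exact: sub UA.
  have [A UA Af] := open_cover_point ((f, false) : space duplicate) (hU n).
  by exists A => //; have [l hl] := sub n A f UA Af; exact: hl.
exists F; split=> [n|]; first by have [] := hF n.
split=> [A [n _ FA]|]; first by apply: (hU n).1; have [_ FU _] := hF n; exact: FU.
apply/seteqP; split=> // -[f b] _; have [_ _ /(_ f)[A FA Af]] := hF 0.
by exists A; [exists 0 | exact: Af].
Qed.

Lemma duplicate_not_S1_O_D : ~ satisfies (space duplicate) S1_O_D.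
Proof.
pose half n b : set (space duplicate) := [set y | y.1 n = b].
case/(_ (fun n => range (half n))) => [n|V [hV dV]].
  split=> [_ [b _ <-]|].
    apply/openP => -[f [|]] /= fb; first by exists [set (f, true)] => // z ->.
    exists (strip n.+1 f); first by exists n.+1.
    by move=> z zf; rewrite -fb /half /= zf // mem_iota /=.
  by apply/seteqP; split=> // y _; exists (half n (y.1 n)) => //; exists (y.1 n).
have /choice[b hb] n : exists b, half n b = V n by have [b _] := hV n; exists b.
(* The opposite bits give a point outside all the selected halves. *)
pose y : space duplicate := (fun n => ~~ b n, true).
have [||_ [-> [_ [n _ <-]]]] := dV [set y]; first by exists y.
  by apply/openP => _ ->; exists [set y].
by rewrite -hb /half /=; case: (b n).
Qed.

(** * Trees of excluded cylinders *)

Notation excl := (seq (seq bool)).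

Definition escapes (x : reals) (t : seq bool) : bool := t != mkseq x (size t).

(** Only [g 0], ..., [g k.-1] matter: a finite family is coded by its length
    and a total function, so that for fixed length the families form a Cantor
    cube. *)
Definition avoids (k : nat) (g : nat -> nat -> reals) (s : excl) : Prop :=
  forall i n, i < k -> n < size s -> escapes (g i n) (nth [::] s n).

Definition join (k : nat) (g h : nat -> nat -> reals) (i : nat) : nat -> reals :=
  if i < k then g i else h (i - k).

Lemma avoids_join k m g h s :
  avoids (k + m) (join k g h) s <-> avoids k g s /\ avoids m h s.
Proof.
split=> [av|[avg avh] i n ilt ns]; last first.
  rewrite /join; case: ltnP => ik; first exact: avg.
  by apply: avh; rewrite ?ltn_subLR.
split=> i n ilt ns.
  by have := av i n _ ns; rewrite /join ilt; apply; rewrite ltn_addr.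
have := av (k + i) n _ ns; have -> : join k g h (k + i) = h i.
  by rewrite /join ltnNge leq_addr addKn.
by apply; rewrite ltn_add2l.
Qed.

(** A string that differs from [g i n] at position [i], hence is an initial
    segment of none of the [k] sequences. *)
Definition diagonal (k : nat) (g : nat -> nat -> reals) (n : nat) : seq bool :=
  mkseq (fun i => ~~ g i n i) k.

Lemma escapes_diagonal k g i n : i < k -> escapes (g i n) (diagonal k g n).
Proof.
move=> ik; apply/eqP; rewrite size_mkseq => /(congr1 (nth false ^~ i)).
by rewrite !nth_mkseq //; case: (g i n i).
Qed.

(** The node [s] continued forever by the diagonal strings; its finite segments
    show that a node avoided by [g] has extensions of every length still
    avoided by [g]. *)
Definition extension (k : nat) (g : nat -> nat -> reals) (s : excl) (n : nat)
    : seq bool :=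
  if n < size s then nth [::] s n else diagonal k g n.

Lemma avoids_extension k g s N :
  avoids k g s -> avoids k g (mkseq (extension k g s) N).
Proof.
move=> av i n ik; rewrite size_mkseq => nN; rewrite nth_mkseq // /extension.
by case: ifP => ns; [exact: av | exact: escapes_diagonal].
Qed.

Lemma prefix_mkseq (T : eqType) (p : nat -> T) M N :
  M <= N -> prefix (mkseq p M) (mkseq p N).
Proof.
move=> MN; rewrite prefixE size_mkseq.
by rewrite /mkseq -map_take take_iota (minn_idPl MN).
Qed.

Lemma mkseq_of_prefix (T : eqType) (p : nat -> T) (s : seq T) N :
  prefix s (mkseq p N) -> mkseq p (size s) = s.
Proof.
move=> sp; have sN : size s <= N by have := size_prefix sp; rewrite size_mkseq.
move: sp; rewrite prefixE => /eqP {2}<-.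
by rewrite /mkseq -map_take take_iota (minn_idPl sN).
Qed.

Lemma mkseq_extension k g s : mkseq (extension k g s) (size s) = s.
Proof.
rewrite -[RHS](mkseq_nth [::]) /mkseq; apply/eq_in_map => n.
by rewrite mem_iota /extension /= => ->.
Qed.

Lemma prefix_extension k g s N :
  size s <= N -> prefix s (mkseq (extension k g s) N).
Proof. by move=> sN; rewrite -{1}(mkseq_extension k g s) prefix_mkseq. Qed.

(** Avoidance of [s] depends on finitely many bits only, so it is a clopen
    condition on the tuple. *)
Lemma avoids_local k g s : exists l : seq (nat * nat * nat), forall h,
  {in l, forall p, h p = g p.1.1 p.1.2 p.2} ->
  avoids k (fun i n j => h (i, n, j)) s <-> avoids k g s.
Proof.
pose m := \max_(t <- s) size t.
exists [seq (p, j) | p <- [seq (i, n) | i <- iota 0 k, n <- iota 0 (size s)],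
  j <- iota 0 m] => h hg.
have e i n : i < k -> n < size s ->
    escapes (fun j => h (i, n, j)) (nth [::] s n) = escapes (g i n) (nth [::] s n).
  move=> ik ns; rewrite /escapes; congr (_ != _); apply/eq_in_map => j.
  rewrite mem_iota /= => jt; rewrite hg //.
  apply/allpairsP; exists ((i, n), j); split=> //=.
    by apply/allpairsP; exists (i, n); rewrite !mem_iota.
  rewrite mem_iota /=; apply: leq_trans jt _.
  by rewrite /m; apply: (@leq_bigmax_seq _ _ xpredT size) => //; exact: mem_nth.
by split=> av i n ik ns; have := av i n ik ns; rewrite e.
Qed.

(** The tuples failing to avoid [s], together with those avoiding some
    extension of [s] in [D], form an open cover of the Cantor cube of all
    tuples. The index [None] stands for the former set. *)
Lemma finite_capture (D : set excl) (s : excl) (k : nat) :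
  (forall g, avoids k g s -> exists d, [/\ D d, prefix s d & avoids k g d]) ->
  exists E : set excl, [/\ finite_set E, E `<=` D &
    forall g, avoids k g s -> exists d, [/\ E d, prefix s d & avoids k g d]].
Proof.
move=> hD; pose curry (f : nat * nat * nat -> bool) i n j := f (i, n, j).
pose O (o : option excl) := [set f | if o is Some d
  then prefix s d /\ avoids k (curry f) d else ~ avoids k (curry f) s].
have [||E [Ef ED EO]] := @cantor_finite_subcover _ _
  [set o | if o is Some d then D d else True] O.
- move=> [d|] f _ /= h.
    have [l hl] := avoids_local k (curry f) d; exists l => g gf.
    split; first exact: h.1.
    by apply: (proj2 (hl g _) h.2) => -[[i n] j] /gf.
  have [l hl] := avoids_local k (curry f) s; exists l => g gf av.
  by apply/h/(proj1 (hl g _) av) => -[[i n] j] /gf.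
- move=> f; have [av|nav] := pselect (avoids k (curry f) s).
    by have [d [Dd sd fd]] := hD _ av; exists (Some d).
  by exists None.
exists (Some @^-1` E); split=> [|d /ED //|g av].
  by apply: finite_preimage => // a b _ _ [].
by have [[d|] Eo /=] := EO (fun p => g p.1.1 p.1.2 p.2); [case; exists d |].
Qed.

(** The relation [R n d A] reads: the node [d] witnesses that the member [A] of
    the [n]-th family meets a neighbourhood. There are countably many pairs
    [(k, s)], and step [n] deals with the one of code [n]. *)
Lemma countable_capture (T : Type) (R : nat -> excl -> T -> Prop) :
  (forall n k g s, avoids k g s ->
    exists d A, [/\ R n d A, prefix s d & avoids k g d]) ->
  exists F : nat -> set T,
    (forall n, finite_set (F n) /\ forall A, F n A -> exists d, R n d A) /\
    forall k g s, avoids k g s ->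
      exists n d A, [/\ F n A, R n d A, prefix s d & avoids k g d].
Proof.
move=> hR.
have /choice[L hL] n : exists E : set excl, [/\ finite_set E,
    E `<=` [set d | exists A, R n d A] &
    forall k s, choice.unpickle n = Some (k, s) :> option (nat * excl) ->
      forall g, avoids k g s ->
      exists d, [/\ E d, prefix s d & avoids k g d]].
  case E : (choice.unpickle n : option (nat * excl)) => [[k s]|]; last first.
    by exists set0; split.
  have [g /(hR n)[d [A [RA sd gd]]]|L [Lf LD Lc]] :=
    @finite_capture [set d | exists A, R n d A] s k.
    by exists d; split=> //; exists A.
  by exists L; split=> // _ _ [<- <-].
have /choice[a ha] n : exists a : excl -> T,
    forall d, (exists A, R n d A) -> R n d (a d).
  (* [A0] is the value of the choice function at nodes without a witness. *)
  have [[d0 [A0 _]]|no] := pselect (exists d A, R n d A); last first.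
    have [|d [A [RA _ _]]] := hR n 0 (fun _ _ _ => false) [::]; first by move=> ?.
    by case: no; exists d, A.
  have /choice[a ha] d : exists A, (exists A', R n d A') -> R n d A.
    by have [[A RA]|nA] := pselect (exists A, R n d A); [exists A|exists A0 => /nA].
  by exists a.
exists (fun n => a n @` L n); split=> [n|k g s av].
  have [Lf LD _] := hL n; split; first exact: finite_image.
  by move=> _ [d /LD ? <-]; exists d; exact: ha.
have [_ LD /(_ k s (choice.pickleK (k, s)) g av)[d [Ld sd gd]]] :=
  hL (choice.pickle (k, s)).
exists (choice.pickle (k, s)), d, (a (choice.pickle (k, s)) d).
by split=> //; exact/ha/LD.
Qed.

Definition tree_nbhd k g s : set excl := [set d | prefix s d /\ avoids k g d].

Definition tree : nbhd_system excl.
Proof.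
exists (fun s => [set N | exists k g, avoids k g s /\ N = tree_nbhd k g s]).
- by move=> s; eexists; exists 0, (fun _ _ _ => false); split.
- move=> s _ _ [k [g [gs ->]]] [m [h [hs ->]]].
  exists (tree_nbhd (k + m) (join k g h) s).
    by exists (k + m), (join k g h); split=> //; apply/avoids_join.
  by move=> d [sd /avoids_join[]].
Defined.

Lemma tree_nbhd_open k g s : open (tree_nbhd k g s : set (space tree)).
Proof.
apply/openP => d [sd gd]; exists (tree_nbhd k g d); first by exists k, g.
by move=> e [de ge]; split=> //; exact: prefix_trans de.
Qed.

Lemma tree_Sfin_D_D : satisfies (space tree) Sfin_D_D.
Proof.
move=> U dU.
have [n k g s gs|F [hF cF]] := @countable_capture (set (space tree))
    (fun n d A => U n A /\ A d).
  have [||d [[sd gd] [A UA Ad]]] := dU n (tree_nbhd k g s).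
  - by exists s; split=> //; exact: prefix_refl.
  - exact: tree_nbhd_open.
  by exists d, A.
exists F; split=> [n|O [s Os] /openP/(_ s Os)[_ [k [g [gs ->]]] NO]].
  by split=> [|A /(hF n).2[d []]]; first exact: (hF n).1.
have [n [d [A [FA [UA Ad] sd gd]]]] := cF k g s gs.
by exists d; split; [exact: NO | exists A => //; exists n].
Qed.

Lemma avoids1 (g : nat -> reals) s :
  avoids 1 (fun=> g) s <-> forall n, n < size s -> escapes (g n) (nth [::] s n).
Proof. by split=> [av n ns|av i n _ ns]; [exact: (av 0)|exact: av]. Qed.

(** The diagonalisation behind the failure of S1: [nth false t] is an infinite
    sequence with initial segment [t], so no node with entry [t] at [n] is
    avoided by a [g] whose [n]-th component is [nth false t]. *)
Lemma escapesN t : escapes (nth false t) t = false.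
Proof. by rewrite /escapes mkseq_nth eqxx. Qed.

Lemma tree_not_S1_Do_D : ~ satisfies (space tree) S1_Do_D.
Proof.
pose at_ n t : set (space tree) := [set d : excl | n < size d /\ nth [::] d n = t].
case/(_ (fun n => range (at_ n))) => [n|V [hV dV]].
  split=> [O [s Os] /openP/(_ s Os)[_ [k [g [gs ->]]] NO]|_ [t _ <-]].
    pose d := mkseq (extension k g s) (size s + n.+1).
    exists d; split.
      by apply: NO; split; [exact/prefix_extension/leq_addr|exact: avoids_extension].
    exists (at_ n (nth [::] d n)); first by exists (nth [::] d n).
    by split=> //; rewrite size_mkseq addnS ltnS leq_addl.
  apply/openP => d [nd dt]; exists (tree_nbhd 0 (fun _ _ _ => false) d).
    by exists 0, (fun _ _ _ => false).
  move=> _ [/prefixP[e ->] _]; split; first by rewrite size_cat ltn_addr.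
  by rewrite nth_cat nd.
have /choice[t ht] n : exists t, at_ n t = V n by have [t _] := hV n; exists t.
have [||d [[_ /avoids1 av] [_ [n _ <-]]]] :=
  dV (tree_nbhd 1 (fun=> fun n => nth false (t n)) [::]).
- by exists [::]; split.
- exact: tree_nbhd_open.
by rewrite -ht => -[nd dn]; have := av n nd; rewrite dn escapesN.
Qed.

Definition branch_nbhd k g s : set (nat -> seq bool) :=
  [set p | mkseq p (size s) = s /\ forall N, avoids k g (mkseq p N)].

Lemma branch_nbhd_prefix k g s d :
  prefix s d -> branch_nbhd k g d `<=` branch_nbhd k g s.
Proof.
by move=> sd p [pd gp]; split=> //; apply: (@mkseq_of_prefix _ p s (size d)); rewrite pd.
Qed.

Definition branches : nbhd_system (nat -> seq bool).
Proof.
exists (fun p => [set A | exists k g N,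
  (forall M, avoids k g (mkseq p M)) /\ A = branch_nbhd k g (mkseq p N)]).
- by move=> p; eexists; exists 0, (fun _ _ _ => false), 0; split.
- move=> p _ _ [k [g [M [gp ->]]]] [m [h [N [hp ->]]]].
  exists (branch_nbhd (k + m) (join k g h) (mkseq p (M + N))).
    exists (k + m), (join k g h), (M + N); split=> // L.
    by apply/avoids_join.
  move=> q [qp av].
  by split; [apply: branch_nbhd_prefix (prefix_mkseq p (leq_addr N M)) _ _
    |apply: branch_nbhd_prefix (prefix_mkseq p (leq_addl M N)) _ _];
    split=> // L; have /avoids_join[] := av L.
Defined.

Lemma branch_nbhd_open k g s : open (branch_nbhd k g s : set (space branches)).
Proof.
apply/openP => p [ps gp]; exists (branch_nbhd k g s) => //.
by exists k, g, (size s); rewrite ps.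
Qed.

Lemma branch_nbhd_extension k g s :
  avoids k g s -> branch_nbhd k g s (extension k g s).
Proof. by move=> gs; split=> [|N]; [exact: mkseq_extension|exact: avoids_extension]. Qed.

(** A member [A] of the [n]-th family is witnessed at a node [d] when some
    nonempty [branch_nbhd m h d] is contained in [A]. If moreover [g] avoids
    [d], the branch extending [d] diagonally against [h] and [g] together lies
    both in [A] and in the neighbourhood given by [g]. *)
Lemma branches_Sfin_Do_D : satisfies (space branches) Sfin_Do_D.
Proof.
move=> U dU.
pose R n d A := U n A /\ exists k g, avoids k g d /\ branch_nbhd k g d `<=` A.
have [n k g s gs|F [hF cF]] := @countable_capture (set (space branches)) R.
  have [||p [[ps gp] [A UA Ap]]] := (dU n).1 (branch_nbhd k g s).
  - by exists (extension k g s); exact: branch_nbhd_extension.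
  - exact: branch_nbhd_open.
  have /openP/(_ p Ap)[_ [m [h [N [hp ->]]]] NA] := (dU n).2 _ UA.
  exists (mkseq p (size s + N)), A; split=> //.
  - split=> //; exists m, h; split=> //.
    apply: subset_trans NA.
    exact/branch_nbhd_prefix/prefix_mkseq/leq_addl.
  - by rewrite -{1}ps prefix_mkseq // leq_addr.
exists F; split=> [n|O [p Op] /openP/(_ p Op)[_ [k [g [N [gp ->]]]] NO]].
  by split=> [|A /(hF n).2[d []]]; first exact: (hF n).1.
have [n [d [A [FA [UA [m [h [hd NA]]]] sd gd]]]] := cF k g _ (gp N).
pose q := extension (m + k) (join m h g) d.
have [qd av] : branch_nbhd (m + k) (join m h g) d q.
  by apply/branch_nbhd_extension/avoids_join.
exists q; split; last first.
  by exists A; [exists n | apply: NA; split=> // L; have /avoids_join[] := av L].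
apply/NO/(branch_nbhd_prefix sd); split=> // L.
by have /avoids_join[] := av L.
Qed.

Lemma branches_not_S1_O_D : ~ satisfies (space branches) S1_O_D.
Proof.
pose at_ n t : set (space branches) := [set p | p n = t].
case/(_ (fun n => range (at_ n))) => [n|V [hV dV]].
  split=> [_ [t _ <-]|]; last first.
    by apply/seteqP; split=> // p _; exists (at_ n (p n)) => //; exists (p n).
  apply/openP => p pt; exists (branch_nbhd 0 (fun _ _ _ => false) (mkseq p n.+1)).
    by exists 0, (fun _ _ _ => false), n.+1.
  move=> q []; rewrite size_mkseq => /(congr1 (nth [::] ^~ n)).
  by rewrite !nth_mkseq // => + _; rewrite pt.
have /choice[t ht] n : exists t, at_ n t = V n by have [t _] := hV n; exists t.
pose g (i n : nat) := nth false (t n).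
have [||p [[_ av] [_ [n _ <-]]]] := dV (branch_nbhd 1 g [::]).
- by exists (extension 1 g [::]); exact: branch_nbhd_extension.
- exact: branch_nbhd_open.
rewrite -ht => pn; have := av n.+1 0 n isT; rewrite size_mkseq nth_mkseq //.
by rewrite pn escapesN => /(_ (ltnSn n)).
Qed.

(** * The separations *)

(* Nonemptiness is explicit: on the empty space every S1 property fails (the
   empty family is a dense family and an open cover) while every Sfin property
   holds, so the arrow Sfin(D,D) -> S1(O,D) presupposes nonempty spaces. *)
Theorem theorem2p27 (P Q : property) (hPQ : ~ diagram_path P Q) :
  exists X : topologicalType,
    [/\ [set: X] !=set0, satisfies X P & ~ satisfies X Q].
Proof.
(* The arrows transport one example to every pair in its reach. *)
have sep (T : Type) (S : nbhd_system T) (x : T) P0 Q0 :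
    satisfies (space S) P0 -> ~ satisfies (space S) Q0 ->
    diagram_path P0 P -> diagram_path Q Q0 ->
    exists X : topologicalType,
      [/\ [set: X] !=set0, satisfies X P & ~ satisfies X Q].
  move=> XP0 XQ0 P0P QQ0; have X0 : [set: space S] !=set0 by exists x.
  exists (space S); split=> //; first exact: satisfies_path P0P XP0.
  by move=> /(satisfies_path X0 QQ0).
have E1 := sep _ _ (fun=> false) _ _
  particular_point_S1_D_D particular_point_not_Sfin_O_O.
have E2 := sep _ _ None _ _
  discrete_with_focal_S1_O_O discrete_with_focal_not_Sfin_Do_D.
have E3 := sep _ _ [::] _ _ tree_Sfin_D_D tree_not_S1_Do_D.
have E4 := sep _ _ (fun=> false) _ _ cocountable_S1_Do_D cocountable_not_Sfin_D_D.
have E5 := sep _ _ (fun=> [::]) _ _ branches_Sfin_Do_D branches_not_S1_O_D.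
have E6 := sep _ _ (fun=> false, true) _ _ duplicate_Sfin_O_O duplicate_not_S1_O_D.
have path0 R : diagram_path R R := @rt_refl _ _ R.
have path1 R S : arrow R S -> diagram_path R S := @rt_step _ _ R S.
have path2 R S T : arrow R S -> arrow S T -> diagram_path R T.
  by move=> /path1 RS /path1; exact: rt_trans RS.
have path3 R S T W : arrow R S -> arrow S T -> arrow T W -> diagram_path R W.
  by move=> /path1 RS; move=> /path2/[apply]; exact: rt_trans RS.
(* Properties joined by a path are joined by one of at most three arrows. *)
destruct P, Q;
  solve [ case: hPQ; eauto using arrow | apply: E1; eauto using arrow
  | apply: E2; eauto using arrow | apply: E3; eauto using arrow
  | apply: E4; eauto using arrow | apply: E5; eauto using arrow
  | apply: E6; eauto using arrow ].
Qed.
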